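(* Let $\Omega\subset\mathbb{R}^{16}$ be open. The complexified octonionic Cauchy–Riemann operator $D=\partial_x+i\partial_y$ and its octonionic conjugate $\overline{D}=\partial_{\overline{x}}+i\partial_{\overline{y}}$ satisfy $$D\overline{D}=\overline{D}D=\widetilde{\Delta}+2i\langle\partial_x,\partial_y\rangle,$$ that is, for every twice differentiable $f:\Omega\to\mathbb{O}_{\mathbb{C}}$, $$D(\overline{D}f)=\overline{D}(Df)=\widetilde{\Delta}f+2i\langle\partial_x,\partial_y\rangle f.$$
   Context: $\mathbb{O}$ is the real octonion algebra with basis $e_0=1,e_1,\dots,e_7$: here $1,e_1,e_2,e_3=e_1e_2$ span the quaternions $\mathbb{H}$, $e_5=e_1e_4$, $e_6=e_2e_4$, $e_7=e_3e_4$, every octonion is $a+be_4$ with $a,b\in\mathbb{H}$, and the product is $(a+be_4)(c+de_4)=(ac-\overline{d}b)+(b\overline{c}+da)e_4$, where the overline is quaternionic conjugation. $\mathbb{O}_{\mathbb{C}}=\mathbb{O}\otimes\mathbb{C}$ consists of elements $z=x+iy$ with $x,y\in\mathbb{O}$; $i$ is the complex imaginary unit, commuting with all $e_j$, and the product is extended $\mathbb{C}$-bilinearly. Identify $\mathbb{R}^{16}$ with $\mathbb{O}_{\mathbb{C}}$ via the coordinates $(x_0,\dots,x_7,y_0,\dots,y_7)$ of $x=\sum_j x_je_j$, $y=\sum_j y_je_j$. The real octonionic Cauchy–Riemann operators are $\partial_x=\sum_{j=0}^7 e_j\partial_{x_j}$, $\partial_{\overline{x}}=\partial_{x_0}-\sum_{j=1}^7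 e_j\partial_{x_j}$, and likewise $\partial_y=\sum_{j=0}^7 e_j\partial_{y_j}$, $\partial_{\overline{y}}=\partial_{y_0}-\sum_{j=1}^7 e_j\partial_{y_j}$. They act from the left, e.g. $\partial_x f=\sum_j e_j\,\partial_{x_j}f$, and a composition of operators means successive application: $(AB)f=A(Bf)$. $\widetilde{\Delta}=\Delta_x-\Delta_y$ with $\Delta_x=\sum_{j=0}^7\partial_{x_j}^2$, $\Delta_y=\sum_{j=0}^7\partial_{y_j}^2$, and $\langle\partial_x,\partial_y\rangle=\sum_{j=0}^7\partial_{x_j}\partial_{y_j}$. *)

(* Defs.v *)
From HB Require Import structures.
From mathcomp Require Import all_boot all_order all_algebra.
From mathcomp Require Import all_classical all_reals all_analysis.
Set Implicit Arguments.
Unset Strict Implicit.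
Unset Printing Implicit Defensive.
Import Order.TTheory GRing.Theory Num.Theory.
Import numFieldNormedType.Exports.
Local Open Scope classical_set_scope.
Local Open Scope ring_scope.

(* A quaternion is the row of its coordinates in the basis 1, e_1, e_2, e_3;
   an octonion a + b e_4 is the row (a | b), which lists its coordinates in
   the basis e_0, ..., e_7 because e_5 = e_1 e_4, e_6 = e_2 e_4, e_7 = e_3 e_4;
   a complexified octonion x + i y is the row (x | y), which is also the
   identification of R^16 with the complexified octonions. *)
Notation quaternion R := 'rV[R]_4 (only parsing).
Notation octonion R := 'rV[R]_(4 + 4) (only parsing).
Notation coctonion R := 'rV[R]_(8 + 8) (only parsing).

Section Algebra.
Context {R : pzRingType}.

Definition quat_mul (p q : quaternion R) : quaternion R :=
  \row_k [:: p 0 0 * q 0 0 - p 0 1 * q 0 1 - p 0 2 * q 0 2 - p 0 3 * q 0 3;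
             p 0 0 * q 0 1 + p 0 1 * q 0 0 + p 0 2 * q 0 3 - p 0 3 * q 0 2;
             p 0 0 * q 0 2 - p 0 1 * q 0 3 + p 0 2 * q 0 0 + p 0 3 * q 0 1;
             p 0 0 * q 0 3 + p 0 1 * q 0 2 - p 0 2 * q 0 1 + p 0 3 * q 0 0]`_k.

Definition quat_conj (p : quaternion R) : quaternion R :=
  \row_k (if k == 0 then p 0 k else - p 0 k).

Definition oct_mul (u v : octonion R) : octonion R :=
  let a := lsubmx u in let b := rsubmx u in
  let c := lsubmx v in let d := rsubmx v in
  row_mx (quat_mul a c - quat_mul (quat_conj d) b)
         (quat_mul b (quat_conj c) + quat_mul d a).

Definition coct_mul (z w : coctonion R) : coctonion R :=
  let x := lsubmx z in let y := rsubmx z in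
  let u := lsubmx w in let v := rsubmx w in
  row_mx (oct_mul x u - oct_mul y v) (oct_mul x v + oct_mul y u).

Definition coct_e (j : 'I_8) : coctonion R := row_mx (delta_mx 0 j) 0.

(* the complex imaginary unit *)
Definition coct_i : coctonion R := row_mx 0 (delta_mx 0 0).

End Algebra.

Section Operators.
Context {R : realType}.
Implicit Types f : 'rV[R]_(8 + 8) -> coctonion R.

Definition pdx (j : 'I_8) f : 'rV[R]_(8 + 8) -> coctonion R :=
  fun z => 'D_(delta_mx 0 (lshift 8 j)) f z.

Definition pdy (j : 'I_8) f : 'rV[R]_(8 + 8) -> coctonion R :=
  fun z => 'D_(delta_mx 0 (rshift 8 j)) f z.

Definition CRx f z := \sum_(j < 8) coct_mul (coct_e j) (pdx j f z).
Definition CRy f z := \sum_(j < 8) coct_mul (coct_e j) (pdy j f z).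

Definition CRx_conj f z :=
  pdx 0 f z - \sum_(j < 8 | j != 0) coct_mul (coct_e j) (pdx j f z).
Definition CRy_conj f z :=
  pdy 0 f z - \sum_(j < 8 | j != 0) coct_mul (coct_e j) (pdy j f z).

Definition CR f z := CRx f z + coct_mul coct_i (CRy f z).
Definition CR_conj f z := CRx_conj f z + coct_mul coct_i (CRy_conj f z).

Definition laplacian_x f z := \sum_(j < 8) pdx j (pdx j f) z.
Definition laplacian_y f z := \sum_(j < 8) pdy j (pdy j f) z.
Definition laplacian_tilde f z := laplacian_x f z - laplacian_y f z.

Definition mixed_xy f z := \sum_(j < 8) pdx j (pdy j f) z.

(* Differentiability is in the sense of Frechet; the second derivative is the
   derivative of the matrix-valued map sending z to the Jacobian of f at z. *)
Definition twice_differentiable_on (Omega : set 'rV[R]_(8 + 8)) f :=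
  forall z, Omega z -> differentiable f z /\ differentiable (jacobian f) z.

End Operators.

(* Main.v *)
(* D and its conjugate are first order operators f |-> \sum_a c_a * d_a f, where
   c_a is the a-th standard basis vector of R^16, respectively its octonionic
   conjugate, seen as a complexified octonion.  Hence D (D^conj f) is the sum of
   the c_a * (conj c_b * (d_a d_b f)).  The Hessian is symmetric, so the terms
   (a, b) and (b, a) can be added, and the linearized alternative law
   u (v^conj w) + v (u^conj w) = 2 <u, v> w, with the complex bilinear form
   <,>, collapses the sum without any use of associativity.  Symmetry of the
   Hessian at a point where the gradient is merely differentiable is Young's
   theorem: the second difference quotient converges to both mixed derivatives. *)
Require Import Defs.
From HB Require Import structures.
From mathcomp Require Import all_boot all_order all_algebra.
From mathcomp Require Import all_classical all_reals all_analysis.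
From mathcomp Require Import ring.
Set Implicit Arguments.
Unset Strict Implicit.
Unset Printing Implicit Defensive.
Import Order.TTheory GRing.Theory Num.Theory.
Import numFieldNormedType.Exports.
Local Open Scope classical_set_scope.
Local Open Scope ring_scope.

(* A matrix key of its own keeps rewriting from unfolding [quat_mul] or
   [quat_conj] to match [quat]. *)
Fact quat_key : unit. Proof. by []. Qed.

(** * Quaternion and octonion algebra in coordinates, and the polarized alternative law *)

Section Algebra.
Context {R : comNzRingType}.
Implicit Types (p q : quaternion R) (u v w : octonion R) (z : coctonion R).

Definition quat (a b c d : R) : quaternion R :=
  \matrix[quat_key]_(i, k) [:: a; b; c; d]`_k.

Lemma quatE p : p = quat (p 0 0) (p 0 1) (p 0 2) (p 0 3).
Proof.
apply/rowP => k; rewrite mxE.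
by case: k => [[|[|[|[|k]]]]] //= kP; congr (p 0 _); apply/val_inj.
Qed.

Lemma quat_mulE a b c d a' b' c' d' :
  quat_mul (quat a b c d) (quat a' b' c' d') =
  quat (a * a' - b * b' - c * c' - d * d') (a * b' + b * a' + c * d' - d * c')
       (a * c' - b * d' + c * a' + d * b') (a * d' + b * c' - c * b' + d * a').
Proof. by apply/rowP => k; rewrite !mxE. Qed.

Lemma quat_conjE a b c d : quat_conj (quat a b c d) = quat a (- b) (- c) (- d).
Proof. by apply/rowP => -[[|[|[|[|k]]]] kP]; rewrite ?mxE. Qed.

Lemma quatD a b c d a' b' c' d' :
  quat a b c d + quat a' b' c' d' = quat (a + a') (b + b') (c + c') (d + d').
Proof. by apply/rowP => -[[|[|[|[|k]]]] kP]; rewrite ?mxE. Qed.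

Lemma quatN a b c d : - quat a b c d = quat (- a) (- b) (- c) (- d).
Proof. by apply/rowP => -[[|[|[|[|k]]]] kP]; rewrite ?mxE. Qed.

Lemma quatZ k a b c d : k *: quat a b c d = quat (k * a) (k * b) (k * c) (k * d).
Proof. by apply/rowP => -[[|[|[|[|i]]]] kP]; rewrite ?mxE. Qed.

Let quatS := (quat_mulE, quat_conjE, quatD, quatN, quatZ).

Definition oct_conj u : octonion R :=
  row_mx (quat_conj (lsubmx u)) (- rsubmx u).

Definition oct_dot u v : R := \sum_j u 0 j * v 0 j.

Lemma oct_mul_linearr u : linear (oct_mul u).
Proof.
move=> k v w; rewrite /oct_mul scale_row_mx add_row_mx !linearP /=.
move: (lsubmx u) (rsubmx u) (lsubmx v) (rsubmx v) (lsubmx w) (rsubmx w).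
move=> a b c d e f.
rewrite (quatE a) (quatE b) (quatE c) (quatE d) (quatE e) (quatE f) !quatS.
by congr row_mx; congr quat; ring.
Qed.

Lemma oct_mul_linearl u : linear (oct_mul^~ u).
Proof.
move=> k v w; rewrite /oct_mul scale_row_mx add_row_mx !linearP /=.
move: (lsubmx u) (rsubmx u) (lsubmx v) (rsubmx v) (lsubmx w) (rsubmx w).
move=> a b c d e f.
rewrite (quatE a) (quatE b) (quatE c) (quatE d) (quatE e) (quatE f) !quatS.
by congr row_mx; congr quat; ring.
Qed.

(** Polarization of u (u^conj w) = |u|^2 w. In quaternion coordinates it is a polynomial identity
    over a commutative ring, settled by [ring]. *)
Lemma oct_mul_conj_polar u v w :
  oct_mul u (oct_mul (oct_conj v) w) + oct_mul v (oct_mul (oct_conj u) w) =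
  2 * oct_dot u v *: w.
Proof.
rewrite /oct_dot -[X in _ *: X](hsubmxK w) big_split_ord /= !big_ord_recl !big_ord0 /oct_conj.
rewrite -(hsubmxK u) -(hsubmxK v) /oct_mul !row_mxKl !row_mxKr.
move: (lsubmx u) (rsubmx u) (lsubmx v) (rsubmx v) (lsubmx w) (rsubmx w).
move=> a b c d e f.
rewrite !(row_mxEl, row_mxEr) scale_row_mx add_row_mx.
rewrite (quatE a) (quatE b) (quatE c) (quatE d) (quatE e) (quatE f) !quatS.
rewrite !mxE /=.
by congr row_mx; congr quat; ring.
Qed.

HB.instance Definition _ u :=
  GRing.isLinear.Build R (octonion R) (octonion R) *:%R (oct_mul u)
    (oct_mul_linearr u).

Lemma oct_conjK : involutive (@oct_conj).
Proof.
move=> u; rewrite /oct_conj row_mxKl row_mxKr opprK -[RHS]hsubmxK.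
by move: (lsubmx u) => a; rewrite (quatE a) !quatS !opprK.
Qed.

Lemma oct_dot_conj u v : oct_dot (oct_conj u) (oct_conj v) = oct_dot u v.
Proof.
rewrite /oct_dot !big_split_ord /= /oct_conj; congr (_ + _).
  apply: eq_bigr => i _; rewrite !row_mxEl !mxE; case: ifP => // _.
  by rewrite mulrNN.
by apply: eq_bigr => i _; rewrite !row_mxEr !mxE mulrNN.
Qed.

Lemma oct_dot_delta i j : oct_dot (delta_mx 0 i) (delta_mx 0 j) = (i == j)%:R.
Proof.
rewrite /oct_dot (bigD1 i) //= big1 => [|k /negPf ki]; last first.
  by rewrite !mxE ki mul0r.
by rewrite !mxE !eqxx mul1r addr0.
Qed.

Lemma oct_dot0l u : oct_dot 0 u = 0.
Proof. by rewrite /oct_dot big1 // => i _; rewrite mxE mul0r. Qed.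

Lemma oct_dot0r u : oct_dot u 0 = 0.
Proof. by rewrite /oct_dot big1 // => i _; rewrite mxE mulr0. Qed.

Lemma oct_mul0l u : oct_mul 0 u = 0.
Proof.
have := oct_mul_linearl u (-1) 0 0.
by rewrite scaler0 addr0 scaleN1r addNr.
Qed.

Lemma oct_mul1l u : oct_mul (delta_mx 0 0) u = u.
Proof.
rewrite -[RHS]hsubmxK /oct_mul.
have -> : lsubmx (delta_mx 0 0 : octonion R) = quat 1 0 0 0.
  by apply/rowP => -[[|[|[|[|k]]]] kP]; rewrite !mxE.
have -> : rsubmx (delta_mx 0 0 : octonion R) = quat 0 0 0 0.
  by apply/rowP => -[[|[|[|[|k]]]] kP]; rewrite !mxE.
move: (lsubmx u) (rsubmx u) => a b; rewrite (quatE a) (quatE b) !quatS.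
by congr row_mx; congr quat; ring.
Qed.

Lemma oct_mulNl u v : oct_mul (- u) v = - oct_mul u v.
Proof.
by have := oct_mul_linearl v (-1) u 0; rewrite !scaleN1r oct_mul0l !addr0.
Qed.

Lemma coct_mul_linearr z : linear (coct_mul z).
Proof.
move=> k v w; rewrite /coct_mul scale_row_mx [RHS]add_row_mx !linearP /=.
by congr row_mx; rewrite addrACA -scalerDr.
Qed.

HB.instance Definition _ z :=
  GRing.isLinear.Build R (coctonion R) (coctonion R) *:%R (coct_mul z)
    (coct_mul_linearr z).

Lemma coct_mul_i z : coct_mul coct_i z = row_mx (- rsubmx z) (lsubmx z).
Proof.
by rewrite /coct_mul /coct_i row_mxKl row_mxKr !oct_mul0l !oct_mul1l sub0r add0r.
Qed.

Lemma coct_mul_2i z : coct_mul (2 *: coct_i) z = 2 *: coct_mul coct_i z.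
Proof.
rewrite /coct_i scale_row_mx scaler0 /coct_mul !row_mxKl !row_mxKr !oct_mul0l.
have H w : oct_mul (2 *: delta_mx 0 0) w = 2 *: w.
  have := oct_mul_linearl w 2 (delta_mx 0 0) 0.
  by rewrite !oct_mul0l !addr0 oct_mul1l.
by rewrite !H !oct_mul1l scale_row_mx !sub0r !add0r scalerN.
Qed.

(** Octonionic conjugation only: the complex unit is left fixed, as in the operator [CR_conj]. *)
Definition coct_conj z : coctonion R :=
  row_mx (oct_conj (lsubmx z)) (oct_conj (rsubmx z)).

Lemma coct_conjK : involutive coct_conj.
Proof. by move=> z; rewrite /coct_conj row_mxKl row_mxKr !oct_conjK hsubmxK. Qed.

(* Real and imaginary parts of the complex bilinear extension of [oct_dot]. *)
Definition coct_dot_re z z' :=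
  oct_dot (lsubmx z) (lsubmx z') - oct_dot (rsubmx z) (rsubmx z').
Definition coct_dot_im z z' :=
  oct_dot (lsubmx z) (rsubmx z') + oct_dot (rsubmx z) (lsubmx z').

Lemma coct_dot_re_conj z z' :
  coct_dot_re (coct_conj z) (coct_conj z') = coct_dot_re z z'.
Proof. by rewrite /coct_dot_re !row_mxKl !row_mxKr !oct_dot_conj. Qed.

Lemma coct_dot_im_conj z z' :
  coct_dot_im (coct_conj z) (coct_conj z') = coct_dot_im z z'.
Proof. by rewrite /coct_dot_im !row_mxKl !row_mxKr !oct_dot_conj. Qed.

(** Complex bilinear extension of [oct_mul_conj_polar]. Scalars here lie in [R], so the complex
    factor 2 <z, z'> acts through its real and imaginary parts. *)
Lemma coct_mul_conj_polar z z' t :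
  coct_mul z (coct_mul (coct_conj z') t) +
  coct_mul z' (coct_mul (coct_conj z) t) =
  2 *: (coct_dot_re z z' *: t + coct_dot_im z z' *: coct_mul coct_i t).
Proof.
rewrite coct_mul_i /coct_mul /coct_conj !row_mxKl !row_mxKr.
rewrite -[X in _ *: X + _](hsubmxK t) /coct_dot_re /coct_dot_im.
move: (lsubmx z) (rsubmx z) (lsubmx z') (rsubmx z') (lsubmx t) (rsubmx t).
move=> x y x' y' a b.
rewrite !linearB !linearD /=.
(* Used at [x'] and [y'], this turns every product with outer factor [x'] or [y'] into one with
   outer factor [x] or [y]. The four nested products left in each component then cancel as opaque
   terms. *)
have P u v w : oct_mul v (oct_mul (oct_conj u) w) =
  2 * oct_dot u v *: w - oct_mul u (oct_mul (oct_conj v) w).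
  by rewrite -oct_mul_conj_polar [RHS]addrAC subrr add0r.
rewrite !(P _ x') !(P _ y').
rewrite !scale_row_mx ![in RHS]add_row_mx [LHS]add_row_mx.
congr row_mx; apply/rowP => k.
  move: (oct_mul _ (oct_mul _ _)) (oct_mul _ (oct_mul _ _)) => A B.
  by move: (oct_mul _ (oct_mul _ _)) (oct_mul _ (oct_mul _ _)) => C D;
    rewrite !mxE; ring.
move: (oct_mul _ (oct_mul _ _)) (oct_mul _ (oct_mul _ _)) => A B.
by move: (oct_mul _ (oct_mul _ _)) (oct_mul _ (oct_mul _ _)) => C D;
  rewrite !mxE; ring.
Qed.

End Algebra.

(** * Directional derivatives and Young's theorem for real-valued functions *)

Section Calculus.
Context {R : realType}.

(** The two difference quotients are the same function of the increment. *)
Lemma is_derive_line (V W : normedModType R) (g : V -> W) (c u : V) (s : R) l :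
  is_derive (c + s *: u) u g l -> is_derive s 1 (fun t : R => g (c + t *: u)) l.
Proof.
move=> [dg dgl].
have E : (fun h => h^-1 *: (((fun t : R => g (c + t *: u)) \o shift s) (h *: (1 : R))
    - g (c + s *: u))) =
  (fun h => h^-1 *: ((g \o shift (c + s *: u)) (h *: u) - g (c + s *: u))).
  apply/funext => h /=; congr (_ *: (g _ - _)).
  by rewrite [h *: 1]mulr1 scalerDl addrCA.
by split; [rewrite /derivable E | rewrite /derive E].
Qed.

(** Such a map is a finite sum of coordinate functions times constant vectors. *)
Lemma linear_mx_continuous (W : normedModType R) m n
  (T : {linear 'M[R]_(m, n) -> W}) : continuous T.
Proof.
have -> : T = (fun M => \sum_i \sum_j M i j *: T (delta_mx i j)) :> (_ -> _).
  apply/funext => M; rewrite {1}(matrix_sum_delta M) linear_sum.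
  by apply: eq_bigr => i _; rewrite linear_sum; apply: eq_bigr => j _; rewrite linearZ.
apply: continuous_big => [|i _]; first exact: add_continuous.
apply: continuous_big => [|j _]; first exact: add_continuous.
move=> M.
apply: (@cvgZr_tmp R W _ (nbhs M) (nbhs_filter M)); exact: coord_continuous.
Qed.

Lemma is_derive_linear_mx (V W : normedModType R) m n
    (T : {linear 'M[R]_(m, n) -> W}) (G : V -> 'M[R]_(m, n)) z v l :
  is_derive z v G l -> is_derive z v (fun y => T (G y)) (T l).
Proof.
move=> [dG Gl].
have E : (fun h => h^-1 *: (((fun y => T (G y)) \o shift z) (h *: v) - T (G z))) =
  T \o (fun h => h^-1 *: ((G \o shift z) (h *: v) - G z)).
  by apply/funext => h /=; rewrite [RHS]linearZ [X in _ = _ *: X]linearB.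
have H : h^-1 *: (((fun y => T (G y)) \o shift z) (h *: v) - T (G z)) @[h --> 0^'] --> T l.
  rewrite E; apply: (@cvg_comp _ _ _ _ T _ (nbhs l)).
    by rewrite -Gl; exact: dG.
  exact: (@linear_mx_continuous _ _ _ T l).
split; first by apply/cvg_ex; exists (T l).
exact/cvg_lim.
Qed.

(** The mean value theorem in the direction [u] turns the second difference into [t] times an
    increment of [gu] by [t *: v], taken near [z]. Differentiability of [gu] at [z] makes that
    increment t L v + o(t). *)
Lemma second_difference_cvg (V : normedModType R) (g gu : V -> R) (z u v : V) :
  (\near z, is_derive z u g (gu z)) -> differentiable gu z ->
  (g (z + t *: u + t *: v) - g (z + t *: u) - g (z + t *: v) + g z) / t ^+ 2
    @[t --> 0^'+] --> 'D_v gu z.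
Proof.
move=> gP dgu; rewrite deriveE//.
set L := 'd gu z.
(* [t * K] bounds the norm of [s *: u + t *: v] for 0 <= s <= t; the 1 keeps [K] positive when [u]
   and [v] vanish. *)
pose K := `|u| + `|v| + 1.
have K0 : 0 < K by rewrite ltr_wpDl// addr_ge0.
apply/cvgrPdist_le => /= e e0.
(* Two remainders, each at most [e / (2 * K) * (t * K)], will add up to [e * t]. *)
have e'0 : 0 < e / (2 * K) by rewrite divr_gt0// mulr_gt0.
have /nbhs_ballP[d /= d0 dP] : \forall h \near (0 : V),
    is_derive (z + h) u g (gu (z + h)) /\
    `|gu (z + h) - gu z - L h| <= e / (2 * K) * `|h|.
  near=> h; split; near: h.
    move: gP; rewrite (near_shift 0) subr0.
    by apply: filterS => h /=; rewrite addrC.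
  have /eqaddoP/(_ _ e'0) := diff_locally dgu.
  apply: filterS => h; rewrite -[_ h]/(gu (h + z) - (gu z + L h)) [h + z]addrC.
  by rewrite opprD addrA.
have inball s t : 0 <= s <= t -> t * K < d ->
    [/\ ball 0 d (s *: u), ball 0 d (s *: u + t *: v),
      `|s *: u| <= t * K & `|s *: u + t *: v| <= t * K].
  move=> /andP[s0 st] tK.
  have t0 : 0 <= t by exact: le_trans st.
  have h1 : `|s *: u| <= t * `|u|.
    by rewrite normrZ ger0_norm// ler_wpM2r.
  have h2 : `|s *: u| <= t * K.
    by rewrite (le_trans h1)// ler_wpM2l// /K -addrA lerDl addr_ge0.
  have h3 : `|s *: u + t *: v| <= t * K.
    rewrite (le_trans (ler_normD _ _))// [`|t *: v|]normrZ (ger0_norm t0).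
    by rewrite (le_trans (lerD h1 (lexx _)))// -mulrDr ler_wpM2l// lerDl.
  by split=> //; rewrite -ball_normE /= sub0r normrN; apply: le_lt_trans tK.
near=> t.
have t0 : 0 < t by [].
have tK : t * K < d.
  rewrite -ltr_pdivlMr//.
  by near: t; apply: nbhs_right_lt; rewrite divr_gt0.
(* The second difference is [phi t - phi 0]. *)
pose phi s := g (z + t *: v + s *: u) - g (z + s *: u).
have phiP s : 0 <= s <= t ->
    is_derive s 1 phi (gu (z + t *: v + s *: u) - gu (z + s *: u)).
  move=> /inball/(_ tK)[/dP[? _] /dP[+ _] _ _]; rewrite addrA addrAC => ?.
  by apply: is_deriveB; exact: is_derive_line.
have [| | c c0t] := MVT t0 (df := fun s => gu (z + t *: v + s *: u) - gu (z + s *: u)) (f := phi).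
- by move=> s; rewrite in_itv /= => /andP[s0 st]; apply: phiP; rewrite !ltW.
- apply: derivable_within_continuous => s; rewrite in_itv /= => /phiP.
  by case.
have {}c0t : 0 <= c <= t by move: c0t; rewrite in_itv /= => /andP[? ?]; rewrite !ltW.
have [/dP[_ b1] /dP[_ b2] n1 n2] := inball _ _ c0t tK.
rewrite /phi !scale0r !addr0 subr0 => phit.
have -> : g (z + t *: u + t *: v) - g (z + t *: u) - g (z + t *: v) + g z =
  (g (z + t *: v + t *: u) - g (z + t *: u) - (g (z + t *: v) - g z)).
  by rewrite [z + t *: v + _]addrAC; ring.
rewrite phit.
rewrite [z + t *: v + _]addrAC.
(* The error is a difference of two first-order remainders of [gu] at [z], divided by [t]; the terms
   [gu z] and [L (c *: u)] cancel. *)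
have -> : L v - (gu (z + c *: u + t *: v) - gu (z + c *: u)) * t / t ^+ 2 =
  ((gu (z + c *: u) - gu z - L (c *: u)) -
   (gu (z + (c *: u + t *: v)) - gu z - L (c *: u + t *: v))) / t.
  have t1 : t != 0 by rewrite gt_eqF.
  have -> : L (c *: u + t *: v) = L (c *: u) + t * L v.
    by rewrite linearD [L (t *: v)]linearZ.
  by rewrite addrA; field.
rewrite normrM normfV (gtr0_norm t0) ler_pdivrMr//.
rewrite (le_trans (ler_normB _ _))//.
rewrite (le_trans (lerD b1 b2))// -mulrDr.
rewrite (@le_trans _ _ (e / (2 * K) * (t * K + t * K)))//.
  by rewrite ler_wpM2l ?(ltW e'0)// lerD.
have K1 : K != 0 by rewrite gt_eqF.
rewrite [leLHS](_ : _ = e * t)//.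
by field.
Unshelve. all: end_near. Qed.

(** The second difference is symmetric in [u] and [v], so both derivatives are limits of the same
    quotient. *)
Lemma derive_comm (V : normedModType R) (g gu gv : V -> R) (z u v : V) :
  (\near z, is_derive z u g (gu z)) -> (\near z, is_derive z v g (gv z)) ->
  differentiable gu z -> differentiable gv z -> 'D_v gu z = 'D_u gv z.
Proof.
move=> gP gP' dgu dgv.
apply: (cvg_unique (@norm_hausdorff _ R)) (second_difference_cvg (v := v) gP dgu) _.
have := second_difference_cvg (v := u) gP' dgv.
by under eq_fun => t do
  rewrite [z + t *: v + t *: u]addrAC [_ - g (z + t *: v) - _]addrAC.
Qed.

End Calculus.

(** * Symmetry of second derivatives for vector-valued maps *)

Section Jacobian.
Context {R : realType} {n m : nat}.
Implicit Types (f : 'rV[R]_n -> 'rV[R]_m) (z u v : 'rV[R]_n).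

(** Near [z] the derivative along [u] is [u *m jacobian f], a fixed linear image of the Jacobian. *)
Lemma is_derive_derive f z u v :
  (\near z, differentiable f z) -> differentiable (jacobian f) z ->
  is_derive z v (fun y => 'D_u f y) (u *m 'D_v (jacobian f) z).
Proof.
move=> df dJ.
apply: (near_eq_is_derive (f := fun y => u *m jacobian f y)).
  by apply: filterS df => y dfy; rewrite deriveEjacobian.
apply: is_derive_linear_mx.
by apply: derivableP; apply: diff_derivable.
Qed.

(** [derive_comm] rests on the mean value theorem and concerns real-valued functions, so it is
    applied to each coordinate of [f]. *)
Lemma derive_derive_comm f z u v :
  (\near z, differentiable f z) -> differentiable (jacobian f) z ->
  'D_v ('D_u f) z = 'D_u ('D_v f) z.
Proof.
move=> df dJ.
have dfw w : \forall y \near z, is_derive y w f (w *m jacobian f y).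
  apply: filterS df => y dfy; rewrite -deriveEjacobian//.
  exact/derivableP/diff_derivable.
have fkE k w : \forall y \near z,
    is_derive y w (fun y => f y 0 k) ((w *m jacobian f y) 0 k).
  apply: filterS (dfw w) => y [dfy <-]; rewrite derive_mx// mxE.
  by apply: derivableP; move/derivable_mxP: dfy; apply.
have dJw (w : 'rV_n) k : differentiable (fun y => (w *m jacobian f y) 0 k) z.
  apply: (@differentiable_comp _ _ _ _ (fun y => w *m jacobian f y) (fun M => M 0 k)).
    apply: (@differentiable_comp _ _ _ _ _ (mulmx w)) => //.
    exact/linear_differentiable/linear_mx_continuous.
  exact: differentiable_coord.
have DE w w' k : 'D_w' (fun y => (w *m jacobian f y) 0 k) z = 'D_w' ('D_w f) z 0 k.
  have [_ ->] := is_derive_derive w w' df dJ.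
  have Jw' : derivable (jacobian f) z w' by exact: diff_derivable.
  have [wJ <-] := is_derive_linear_mx (mulmx w) (derivableP Jw').
  by rewrite [in RHS]derive_mx// mxE.
apply/rowP => k.
have H := derive_comm (fkE k u) (fkE k v) (dJw u k) (dJw v k).
exact: etrans (esym (DE u v k)) (etrans H (DE v u k)).
Qed.

End Jacobian.

(** * The Cauchy-Riemann operators as first-order operators, and their compositions *)

Section Operators.
Context {R : realType}.
Implicit Types (f : 'rV[R]_(8 + 8) -> coctonion R) (z : 'rV[R]_(8 + 8)).

(** Common form of [CR] and [CR_conj], so that one computation serves both compositions. *)
Definition first_order_op (c : 'I_(8 + 8) -> coctonion R) f z :=
  \sum_a coct_mul (c a) ('D_(delta_mx 0 a) f z).

Lemma delta_lshift j : delta_mx 0 (lshift 8 j) = row_mx (delta_mx 0 j) 0 :> coctonion R.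
Proof.
by apply/rowP => k; rewrite !mxE; case: split_ordP => i ->;
  rewrite ?mxE ?(eq_lshift, eq_rlshift) ?andbF.
Qed.

Lemma delta_rshift j : delta_mx 0 (rshift 8 j) = row_mx 0 (delta_mx 0 j) :> coctonion R.
Proof.
by apply/rowP => k; rewrite !mxE; case: split_ordP => i ->;
  rewrite ?mxE ?(eq_rshift, eq_lrshift) ?andbF.
Qed.

(** Absorbs the complex unit of the y-part into the coefficient, so that i e_j becomes a basis
    vector of the second block. *)
Lemma coct_mul_i_real (a : octonion R) w :
  coct_mul coct_i (coct_mul (row_mx a 0) w) = coct_mul (row_mx 0 a) w.
Proof.
by rewrite coct_mul_i /coct_mul !row_mxKl !row_mxKr !oct_mul0l !add0r !subr0 !addr0.
Qed.

Lemma CR_first_order : CR (R := R) = first_order_op (fun a => delta_mx 0 a).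
Proof.
apply/funext => f; apply/funext => z.
rewrite /CR /CRx /CRy /first_order_op [RHS]big_split_ord [X in _ + X = _]linear_sum.
apply: f_equal2; apply: eq_bigr => j _; rewrite /coct_e.
  by rewrite -delta_lshift.
by rewrite [LHS]coct_mul_i_real -delta_rshift.
Qed.

Lemma CR_conj_first_order :
  CR_conj (R := R) = first_order_op (fun a => coct_conj (delta_mx 0 a)).
Proof.
apply/funext => f; apply/funext => z.
have one_mul w : coct_mul (row_mx (delta_mx 0 0) 0) w = w :> coctonion R.
  by rewrite /coct_mul !row_mxKl !row_mxKr !oct_mul0l !oct_mul1l subr0 addr0 hsubmxK.
(* Conjugation fixes e_0 and negates the other units, which matches the separate treatment of index
   0 in [CRx_conj] and [CRy_conj]. *)
have conj_delta j : oct_conj (delta_mx 0 j) =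
   (if j == 0 then delta_mx 0 j else - delta_mx 0 j) :> octonion R.
  apply/rowP => k; rewrite [RHS](fun_if (fun A : octonion R => A 0 k)) /oct_conj.
  case: (split_ordP k) => i ->; rewrite ?row_mxEl ?row_mxEr !mxE.
    case: (lshift 4 i =P j) => [<-|_]; last by rewrite !andbF oppr0 !if_same.
    by rewrite (_ : (lshift 4 i == 0) = (i == 0)).
  case: (rshift 4 i =P j) => [<-|_]; last by rewrite !andbF oppr0 !if_same.
  by rewrite (_ : (rshift 4 i == 0) = false).
have conj0 : oct_conj 0 = 0 :> octonion R.
  by rewrite /oct_conj !linear0 -[RHS]row_mx0; congr row_mx;
    apply/rowP => k; rewrite !mxE oppr0 if_same.
have conj_mul j w : coct_mul (row_mx (oct_conj (delta_mx 0 j)) 0) w =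
    if j == 0 then w else - coct_mul (coct_e j) w :> coctonion R.
  rewrite conj_delta; case: eqP => [->|_]; first exact: one_mul.
  rewrite /coct_e /coct_mul !row_mxKl !row_mxKr !oct_mul0l !subr0 !addr0.
  by rewrite !oct_mulNl [RHS]opp_row_mx.
have conjl j w : coct_mul (coct_conj (delta_mx 0 (lshift 8 j))) w =
    if j == 0 then w else - coct_mul (coct_e j) w :> coctonion R.
  by rewrite -conj_mul delta_lshift /coct_conj row_mxKl row_mxKr conj0.
have conjr j w : coct_mul (coct_conj (delta_mx 0 (rshift 8 j))) w =
    coct_mul coct_i (if j == 0 then w else - coct_mul (coct_e j) w) :> coctonion R.
  rewrite -conj_mul coct_mul_i_real delta_rshift /coct_conj row_mxKl row_mxKr.
  by rewrite conj0.
rewrite /CR_conj /first_order_op big_split_ord /= /CRx_conj /CRy_conj.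
apply: f_equal2.
  rewrite [RHS](bigD1 0) //= conjl eqxx; apply: f_equal2 => //.
  rewrite -sumrN; apply: eq_bigr => j /negPf j0.
  by rewrite conjl j0.
rewrite linearB [RHS](bigD1 0) //= conjr eqxx; apply: f_equal2 => //.
rewrite linear_sum -sumrN; apply: eq_bigr => j /negPf j0.
by rewrite conjr j0 linearN.
Qed.

(** Left multiplication by a constant is linear, so derivatives pass through it. The two products
    stay nested. *)
Lemma first_order_op_comp c d f z :
  (\near z, differentiable f z) -> differentiable (jacobian f) z ->
  first_order_op c (first_order_op d f) z =
  \sum_a \sum_b coct_mul (c a) (coct_mul (d b)
    ('D_(delta_mx 0 a) ('D_(delta_mx 0 b) f) z)).
Proof.
move=> df dJ; apply: eq_bigr => a _; rewrite -linear_sum; congr coct_mul.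
have dd b : is_derive z (delta_mx 0 a) (fun y => coct_mul (d b) ('D_(delta_mx 0 b) f y))
  (coct_mul (d b) ('D_(delta_mx 0 a) ('D_(delta_mx 0 b) f) z)).
  apply: is_derive_linear_mx.
  by apply: derivableP; case: (is_derive_derive (delta_mx 0 b) (delta_mx 0 a) df dJ).
have -> : first_order_op d f = \sum_b (fun y => coct_mul (d b) ('D_(delta_mx 0 b) f y)).
  by apply/funext => y; rewrite fct_sumE.
rewrite derive_sum => [|b]; last by case: (dd b).
by apply: eq_bigr => b _; case: (dd b).
Qed.

(** Twice the sum equals the sum plus its transpose, to which [cd] applies termwise. What remains is
    the Gram matrix of the standard basis for the complex bilinear form. *)
Lemma coct_mul_symmetric_sum (H : 'I_(8 + 8) -> 'I_(8 + 8) -> coctonion R)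
    (c d : 'I_(8 + 8) -> coctonion R) :
  (forall a b, H a b = H b a) ->
  (forall a b w, coct_mul (c a) (coct_mul (d b) w) + coct_mul (c b) (coct_mul (d a) w) =
     2 *: (coct_dot_re (delta_mx 0 a) (delta_mx 0 b) *: w +
           coct_dot_im (delta_mx 0 a) (delta_mx 0 b) *: coct_mul coct_i w)) ->
  \sum_a \sum_b coct_mul (c a) (coct_mul (d b) (H a b)) =
  \sum_j H (lshift 8 j) (lshift 8 j) - \sum_j H (rshift 8 j) (rshift 8 j) +
  coct_mul (2 *: coct_i) (\sum_j H (lshift 8 j) (rshift 8 j)).
Proof.
move=> Hsym cd.
have two0 : 2 != 0 :> R by rewrite pnatr_eq0.
apply: (scalerI two0).
rewrite [LHS]scaler_nat mulr2n [X in _ + X]exchange_big -big_split /=.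
under eq_bigr => a _.
  rewrite -big_split /=.
  under eq_bigr => b _ do rewrite [H b a]Hsym cd.
  rewrite -scaler_sumr; over.
rewrite -scaler_sumr; congr (_ *: _).
have sum_delta (F : 'I_8 -> coctonion R) i : \sum_j (i == j)%:R *: F j = F i.
  rewrite (bigD1 i) //= big1 => [|j /negPf ji]; last by rewrite eq_sym ji scale0r.
  by rewrite eqxx scale1r addr0.
(* Gram matrix by blocks: 1 on the x-block, -1 on the y-block since i^2 = -1, and i times the
   identity on both mixed blocks. *)
have rell i j : coct_dot_re (delta_mx 0 (lshift 8 i)) (delta_mx 0 (lshift 8 j)) = (i == j)%:R :> R.
  by rewrite /coct_dot_re !delta_lshift !row_mxKl !row_mxKr oct_dot_delta oct_dot0l subr0.
have rerr i j : coct_dot_re (delta_mx 0 (rshift 8 i)) (delta_mx 0 (rshift 8 j)) = - (i == j)%:R :> R.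
  by rewrite /coct_dot_re !delta_rshift !row_mxKl !row_mxKr oct_dot_delta oct_dot0l sub0r.
have relr i j : coct_dot_re (delta_mx 0 (lshift 8 i)) (delta_mx 0 (rshift 8 j)) = 0 :> R.
  by rewrite /coct_dot_re delta_lshift delta_rshift !row_mxKl !row_mxKr oct_dot0l oct_dot0r subr0.
have rerl i j : coct_dot_re (delta_mx 0 (rshift 8 i)) (delta_mx 0 (lshift 8 j)) = 0 :> R.
  by rewrite /coct_dot_re delta_lshift delta_rshift !row_mxKl !row_mxKr oct_dot0l oct_dot0r subr0.
have imll i j : coct_dot_im (delta_mx 0 (lshift 8 i)) (delta_mx 0 (lshift 8 j)) = 0 :> R.
  by rewrite /coct_dot_im !delta_lshift !row_mxKl !row_mxKr oct_dot0l oct_dot0r addr0.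
have imrr i j : coct_dot_im (delta_mx 0 (rshift 8 i)) (delta_mx 0 (rshift 8 j)) = 0 :> R.
  by rewrite /coct_dot_im !delta_rshift !row_mxKl !row_mxKr oct_dot0l oct_dot0r addr0.
have imlr i j : coct_dot_im (delta_mx 0 (lshift 8 i)) (delta_mx 0 (rshift 8 j)) = (i == j)%:R :> R.
  by rewrite /coct_dot_im delta_lshift delta_rshift !row_mxKl !row_mxKr oct_dot_delta oct_dot0l addr0.
have imrl i j : coct_dot_im (delta_mx 0 (rshift 8 i)) (delta_mx 0 (lshift 8 j)) = (i == j)%:R :> R.
  by rewrite /coct_dot_im delta_lshift delta_rshift !row_mxKl !row_mxKr oct_dot_delta oct_dot0l add0r.
(* The two mixed blocks contribute equally by symmetry of [H], whence the factor 2i. *)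
transitivity (\sum_i (H (lshift 8 i) (lshift 8 i)
      + coct_mul coct_i (H (lshift 8 i) (rshift 8 i)))
    + \sum_i (coct_mul coct_i (H (lshift 8 i) (rshift 8 i))
      - H (rshift 8 i) (rshift 8 i))).
  rewrite [LHS]big_split_ord; apply: f_equal2; apply: eq_bigr => i _;
    rewrite [LHS]big_split_ord; apply: f_equal2.
  - apply: etrans (sum_delta (fun j => H (lshift 8 i) (lshift 8 j)) i).
    by apply: eq_bigr => j _; rewrite rell imll scale0r addr0.
  - apply: etrans (sum_delta (fun j => coct_mul coct_i (H (lshift 8 i) (rshift 8 j))) i).
    by apply: eq_bigr => j _; rewrite relr imlr scale0r add0r.
  - apply: etrans (sum_delta (fun j => coct_mul coct_i (H (lshift 8 j) (rshift 8 i))) i).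
    by apply: eq_bigr => j _; rewrite rerl imrl scale0r add0r Hsym.
  - apply: etrans (sum_delta (fun j => - H (rshift 8 i) (rshift 8 j)) i).
    by apply: eq_bigr => j _; rewrite rerr imrr scale0r addr0 scaleNr scalerN.
rewrite !big_split /= coct_mul_2i scaler_nat mulr2n (linear_sum (coct_mul coct_i)) sumrN.
by rewrite -[RHS]addrA [X in _ = _ + X]addrC !addrA.
Qed.

End Operators.

Theorem proposition3p4 (R : realType) (Omega : set 'rV[R]_(8 + 8))
    (f : 'rV[R]_(8 + 8) -> coctonion R) :
  open Omega -> twice_differentiable_on Omega f ->
  forall z, Omega z ->
    CR (CR_conj f) z =
      laplacian_tilde f z + coct_mul (2 *: coct_i) (mixed_xy f z) /\
    CR_conj (CR f) z =
      laplacian_tilde f z + coct_mul (2 *: coct_i) (mixed_xy f z).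
Proof.
move=> oO d2f z Oz.
have df : \near z, differentiable f z.
  by apply: filterS (open_nbhs_nbhs (conj oO Oz)) => y /d2f[].
have [_ dJ] := d2f z Oz.
rewrite CR_first_order CR_conj_first_order !first_order_op_comp//.
pose H a b := 'D_(delta_mx 0 a) ('D_(delta_mx 0 b) f) z.
have Hsym a b : H a b = H b a by exact: derive_derive_comm.
split.
  apply: (coct_mul_symmetric_sum Hsym) => a b w.
  exact: coct_mul_conj_polar.
apply: (coct_mul_symmetric_sum Hsym) => a b w.
(* For the reverse order the polar identity is taken at the conjugated basis vectors; conjugation is
   involutive and preserves the bilinear form. *)
by rewrite -{1}[delta_mx 0 b]coct_conjK -{2}[delta_mx 0 a]coct_conjK
  coct_mul_conj_polar coct_dot_re_conj coct_dot_im_conj.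
Qed.
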